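(* Let $n\ge 4$ and let $W_1,W_2,W_3,W_4$ be four general real $n$-planes in $\mathbb{C}^{2n}$. The Schubert problem of $4$-planes $H\subset\mathbb{C}^{2n}$ that have at least a two-dimensional intersection with each of the $W_i$ (that is, $\dim (H\cap W_i)\ge 2$ for $i=1,2,3,4$) has exactly $\binom{n}{2}$ solutions. The number of real solutions is \[ \binom{r}{2}+c, \] where the auxiliary problem of $2$-planes $P\subset\mathbb{C}^{2n}$ meeting each of the $W_i$ nontrivially (that is, $\dim(P\cap W_i)\ge 1$ for $i=1,2,3,4$) has $r$ real solutions and $c$ pairs of complex conjugate solutions, and $r+2c=n$.
   Context: An $m$-plane in $\mathbb{C}^{2n}$ is an $m$-dimensional complex linear subspace. It is real if it equals its complex conjugate, equivalently if it is spanned by vectors in $\mathbb{R}^{2n}$. A pair of complex conjugate solutions is a pair $\{P,\overline{P}\}$ of solutions with $P\ne\overline{P}$. ''General'' means that the quadruple $(W_1,W_2,W_3,W_4)$ lies in a suitable nonempty Zariski open subset of the space of quadruples of $n$-planes. The convention $\binom{r}{2}=r(r-1)/2$ is used (so it is $0$ for $r=0,1$). *)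

(* Defs.v *)
From HB Require Import structures.
From mathcomp Require Import all_boot all_order all_algebra.
From mathcomp Require Import complex.
From mathcomp Require mpoly.
From mathcomp Require Import boolp classical_sets cardinality reals.

Set Implicit Arguments.
Unset Strict Implicit.
Unset Printing Implicit Defensive.

Import Order.TTheory GRing.Theory Num.Theory.
Local Open Scope ring_scope.

Section Grassmannian.
Variables (F : fieldType) (s k m : nat).

Definition grass : set {vspace 'rV[F]_m} := [set W | \dim W = k]%classic.

Definition grass_tuples : set ('I_s -> {vspace 'rV[F]_m}) :=
  [set W | forall i, grass (W i)]%classic.

Definition rowspan (M : 'M[F]_(k, m)) : {vspace 'rV[F]_m} :=
  <<[seq row i M | i <- enum 'I_k]>>%VS.

Lemma mem_rowspan (M : 'M[F]_(k, m)) (v : 'rV[F]_m) :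
  (v \in rowspan M) = (v <= M)%MS.
Proof.
apply/idP/idP => [|/submxP[a ->]].
  move=> /(@coord_span _ _ _ (in_tuple _)) ->.
  apply: summx_sub => i _; apply: scalemx_sub.
  have /mapP[j _ ->] : (in_tuple [seq row j M | j <- enum 'I_k])`_i
      \in [seq row j M | j <- enum 'I_k] by apply: mem_nth.
  exact: row_sub.
rewrite mulmx_sum_row; apply: memv_suml => i _; apply: memvZ.
by apply: memv_span; apply: map_f; rewrite mem_enum.
Qed.

(* The entries of the matrices M 0, ..., M (s - 1), listed in a fixed order. *)
Definition entries (M : 'I_s -> 'M[F]_(k, m)) : 'rV[F]_(s * (k * m)) :=
  mxvec (\matrix_(i < s) mxvec (M i)).

(* Gr(k, m)^s is the quotient by GL_k^s of the s-tuples of k x m matrices of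
   rank k, and it carries the quotient of the Zariski topology: U is open iff
   its preimage is, in the locus of rank k matrices, the complement of the
   common zeros of a set S of polynomials in the matrix entries. *)
Definition zariski_open (U : set ('I_s -> {vspace 'rV[F]_m})) : Prop :=
  (U `<=` grass_tuples)%classic /\
  exists S : set (mpoly.mpoly (s * (k * m)) F),
    forall M : 'I_s -> 'M[F]_(k, m), (forall i, row_free (M i)) ->
      (U (fun i => rowspan (M i)) <->
       exists2 p, S p & mpoly.meval (fun j => entries M 0 j) p != 0).

(* Schubert condition of the k-planes meeting each W i in dimension >= d. *)
Definition schubert_solutions (d : nat) (W : 'I_s -> {vspace 'rV[F]_m}) :
    set {vspace 'rV[F]_m} :=
  [set H | grass H /\ forall i, (d <= \dim (H :&: W i))%N]%classic.

End Grassmannian.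

Section Conjugation.
Variables (C : numClosedFieldType) (m : nat).

(* Conjugation is only semilinear, so the image of W under it is not a limg. *)
Definition conj_plane (W : {vspace 'rV[C]_m}) : {vspace 'rV[C]_m} :=
  <<[seq map_mx Num.conj v | v <- vbasis W]>>%VS.

Lemma mem_conj_plane (W : {vspace 'rV[C]_m}) (v : 'rV[C]_m) :
  (v \in conj_plane W) = (map_mx Num.conj v \in W).
Proof.
have conjvK (u : 'rV[C]_m) : map_mx Num.conj (map_mx Num.conj u) = u.
  by apply/rowP => j; rewrite !mxE conjCK.
have conjvS I (r : seq I) (a : I -> C) (f : I -> 'rV[C]_m) :
    map_mx Num.conj (\sum_(i <- r) a i *: f i) =
    \sum_(i <- r) (a i)^* *: map_mx Num.conj (f i).
  apply/rowP => j; rewrite !(mxE, summxE) rmorph_sum.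
  by apply: eq_bigr => i _; rewrite !mxE rmorphM.
apply/idP/idP.
  move=> /(@coord_span _ _ _ (map_tuple _ (vbasis W))) ->.
  rewrite conjvS; apply: memv_suml => i _; apply: memvZ.
  by rewrite (nth_map 0) ?size_tuple // conjvK vbasis_mem // mem_nth ?size_tuple.
move=> /coord_vbasis e; rewrite -(conjvK v) e conjvS.
apply: memv_suml => i _; apply: memvZ; apply: memv_span; apply: map_f.
by rewrite mem_nth ?size_tuple.
Qed.

Definition real_plane (W : {vspace 'rV[C]_m}) : Prop := W = conj_plane W.

Definition conj_pairs (A : set {vspace 'rV[C]_m}) : set (set {vspace 'rV[C]_m}) :=
  [set B | exists P, [/\ A P, A (conj_plane P), P <> conj_plane P
                       & B = [set P; conj_plane P]]]%classic.

End Conjugation.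

(* Main.v *)
(* Generic quadruples have a normal form: a basis e_i, g_i of the ambient space
   and distinct scalars d_i such that the W_i are spanned respectively by the
   e_i, the g_i, the e_i + g_i and the d_i e_i + g_i.  If dim H = 2k and H meets
   each W_i in dimension at least k, then H projects onto the same k-dimensional
   space B of coordinates along both W_0 and W_1, and H is the sum of the two
   copies of B; the condition on W_3 makes B stable under diag(d).  Since the
   d_i are distinct, B is a coordinate subspace, so the solutions are the planes
   P_I = <e_i, g_i | i in I> with #|I| = k.  When the W_i are real, conjugation
   permutes these planes through an involution s of the indices.  For k = 1, r
   and c count the fixed points and the 2-cycles of s; for k = 2, the real
   solutions correspond to the s-stable pairs, which are either pairs of fixed
   points or 2-cycles. *)

Require Import Defs.
From HB Require Import structures.
From mathcomp Require Import all_boot all_order all_algebra.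
From mathcomp Require Import separable complex.
From mathcomp Require Import (canonicals) mpoly.
From mathcomp Require Import boolp classical_sets cardinality reals.

Set Implicit Arguments.
Unset Strict Implicit.
Unset Printing Implicit Defensive.

Import Order.TTheory GRing.Theory Num.Theory.
Local Open Scope ring_scope.

(** * Counting pairs stable under an involution *)

Lemma card_eq_imfset (T : finType) (U : Type) (A : {set T}) (f : T -> U) :
  {in A &, injective f} -> (f @` [set` A] #= `I_#|A|)%card%classic.
Proof.
move=> f_inj; apply: (@card_eq_trans _ _ _ _ [set` A]%classic).
  by apply: inj_card_eq => x y; rewrite !inE => xA yA; apply: f_inj.
have -> : [set` A]%classic = ((@enum_val T (mem A)) @` setT)%classic.
  apply/seteqP; split=> [x xA | _ [i _ <-]]; last exact: enum_valP.
  by exists (enum_rank_in xA x) => //; rewrite enum_rankK_in.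
apply: (card_eq_trans _ (card_esym card_II)); apply: inj_card_eq.
by move=> i j _ _; apply: enum_val_inj.
Qed.

Section Involution.
Variables (T : finType) (s : T -> T).
Hypothesis sK : involutive s.

Definition fixpts : {set T} := [set i | s i == i].

Definition moved_pairs : {set {set T}} :=
  [set [set i; s i] | i in ~: fixpts].

Let s_pair i : s @: [set i; s i] = [set i; s i].
Proof. by rewrite finset.imsetU1 imset_set1 sK finset.setUC. Qed.

(** The 2-cycles partition the moved points into blocks of size two. *)
Lemma card_fixpts_moved_pairs : (#|fixpts| + 2 * #|moved_pairs|)%N = #|T|.
Proof.
rewrite -(cardsC fixpts) mulnC; congr (_ + _)%N; apply/esym.
apply: card_uniform_partition => [_ /imsetP[i + ->]|].
  by rewrite !inE cards2 eq_sym => ->.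
apply/and3P; split.
- apply/eqP/finset.setP => x; apply/idP/idP.
    case/bigcupP=> _ /imsetP[i + ->]; rewrite !inE => si.
    by case/orP=> /eqP-> //; rewrite sK eq_sym.
  move=> xF; apply/bigcupP; exists [set x; s x]; last by rewrite finset.set21.
  by apply/imsetP; exists x.
- apply/finset.trivIsetP => _ _ /imsetP[i _ ->] /imsetP[j _ ->] neq.
  apply/pred0P => x /=; apply/negbTE/negP; rewrite !inE => /andP[xi xj].
  case/eqP: neq; case/orP: xi => /eqP e; case/orP: xj => /eqP e'; subst x.
  + by rewrite e'.
  + by rewrite e' sK finset.setUC.
  + by rewrite -e' sK finset.setUC.
  + by rewrite -(sK j) -e' sK.
- apply/imsetP => -[i _ e].
  by have := finset.set21 i (s i); rewrite -e inE.
Qed.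

Lemma card_stable_pairs :
  #|[set J : {set T} | (#|J| == 2) && (s @: J == J)]|
  = ('C(#|fixpts|, 2) + #|moved_pairs|)%N.
Proof.
(* The two families are disjoint, since a 2-cycle contains a moved point, so their cardinals add up
   to that of the union. *)
rewrite -cards_draws -cardsUI [X in (_ + X)%N](_ : _ = 0)%N ?addn0.
  congr #|pred_of_set _|; apply/finset.setP => J; rewrite !inE; apply/idP/idP.
    case/andP=> /cards2P[x [y [neq ->]]] /eqP e.
    have := imset_f s (finset.set22 x y); have := imset_f s (finset.set21 x y).
    rewrite e !inE cards2 neq.
    have [sx _|sx /= /eqP sxy _] := eqVneq (s x) x.
      rewrite -{1}sx (inj_eq (inv_inj sK)) eq_sym (negPf neq) /= => sy.
      by rewrite finset.subUset !finset.sub1set !inE sx sy eqxx.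
    by apply/orP; right; apply/imsetP; exists x; rewrite ?inE // sxy.
  case/orP=> [/andP[/fintype.subsetP JF ->]|JP].
    apply/eqP; rewrite -[RHS]imset_id; apply: eq_in_imset => x.
    by move/JF; rewrite inE => /eqP.
  have [i + ->] := imsetP JP.
  by rewrite !inE => si; rewrite s_pair eqxx cards2 (eq_sym i) si.
apply/eqP; rewrite cards_eq0; apply/eqP/finset.setP => J; rewrite !inE.
apply/negbTE/negP => /andP[/andP[/fintype.subsetP JF _]] JP.
have [i + e] := imsetP JP.
by rewrite inE JF // e finset.set21.
Qed.

End Involution.

(** * Row spaces of matrices as subspaces *)

Section RowSpan.
Variables (F : fieldType) (m : nat).
Implicit Types (U V : {vspace 'rV[F]_m}).

Lemma rowspanS k l (A : 'M[F]_(k, m)) (B : 'M[F]_(l, m)) :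
  (rowspan A <= rowspan B)%VS = (A <= B)%MS.
Proof.
apply/subvP/idP => [AB | AB v]; last first.
  by rewrite !mem_rowspan => /submx_trans; apply.
by apply/row_subP => i; rewrite -mem_rowspan AB // mem_rowspan row_sub.
Qed.

Lemma eq_rowspan k l (A : 'M[F]_(k, m)) (B : 'M[F]_(l, m)) :
  (A :=: B)%MS -> rowspan A = rowspan B.
Proof. by move=> AB; apply/vspaceP => v; rewrite !mem_rowspan AB. Qed.

(** A row base has a right inverse, so multiplying it on the left by row vectors is an injective
    linear map, from a space of dimension [\rank A] onto the row space. *)
Lemma dim_rowspan k (A : 'M[F]_(k, m)) : \dim (rowspan A) = \rank A.
Proof.
rewrite (eq_rowspan (eqmx_sym (eq_row_base A))).
have [X AX1] := row_freeP (row_base_free A).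
have -> : rowspan (row_base A) = limg (linfun (mulmxr (row_base A))).
  apply/vspaceP => v; rewrite mem_rowspan; apply/submxP/memv_imgP.
    by case=> a ->; exists a; rewrite ?memvf // lfunE.
  by case=> a _ ->; exists a; rewrite lfunE.
rewrite limg_dim_eq; first by rewrite dimvf /dim /= mul1n.
apply/eqP; rewrite -subv0; apply/subvP => a; rewrite memv_cap memv_ker lfunE /=.
case/andP=> _ /eqP e; rewrite memv0.
by rewrite -(mulmx1 a) -AX1 mulmxA e mul0mx.
Qed.

Lemma capv_rowspan k l (A : 'M[F]_(k, m)) (B : 'M[F]_(l, m)) :
  (rowspan A :&: rowspan B)%VS = rowspan (A :&: B)%MS.
Proof.
by apply/vspaceP => v; rewrite memv_cap !mem_rowspan sub_capmx.
Qed.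

Lemma vspace_rowspan U : exists M : 'M[F]_(\dim U, m), U = rowspan M.
Proof.
exists (\matrix_i (vbasis U)`_i); apply/vspaceP => v; rewrite mem_rowspan.
apply/idP/submxP => [/coord_vbasis e | [a ->]].
  exists (\row_i coord (vbasis U) i v); rewrite mulmx_sum_row [LHS]e.
  by apply: eq_bigr => i _; rewrite mxE rowK.
rewrite mulmx_sum_row; apply: memv_suml => i _; rewrite rowK memvZ //.
by rewrite vbasis_mem // mem_nth ?size_tuple.
Qed.

End RowSpan.

(** * Conjugation of subspaces and of solutions *)

Section ConjPlane.
Variables (C : numClosedFieldType) (m : nat).
Implicit Types U V : {vspace 'rV[C]_m}.

Lemma conj_planeK : involutive (@conj_plane C m).
Proof.
move=> U; apply/vspaceP => v; rewrite !mem_conj_plane -map_mx_comp.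
by congr (_ \in U); apply/rowP => j; rewrite !mxE /= conjCK.
Qed.

Lemma conj_planeS U V : (U <= V)%VS -> (conj_plane U <= conj_plane V)%VS.
Proof.
by move=> /subvP UV; apply/subvP => v; rewrite !mem_conj_plane; apply: UV.
Qed.

Lemma conj_planeI U V :
  conj_plane (U :&: V)%VS = (conj_plane U :&: conj_plane V)%VS.
Proof.
by apply/vspaceP => v; rewrite mem_conj_plane !memv_cap !mem_conj_plane.
Qed.

Lemma conj_plane_rowspan k (M : 'M[C]_(k, m)) :
  conj_plane (rowspan M) = rowspan (map_mx Num.conj M).
Proof.
apply/vspaceP => v; rewrite mem_conj_plane !mem_rowspan.
rewrite -(map_submx (Num.conj : {rmorphism C -> C})) -map_mx_comp.
by congr submx; apply/rowP => j; rewrite !mxE /= conjCK.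
Qed.

Lemma dim_conj_plane U : \dim (conj_plane U) = \dim U.
Proof.
have [M ->] := vspace_rowspan U.
rewrite conj_plane_rowspan !dim_rowspan.
by rewrite (mxrank_map (Num.conj : {rmorphism C -> C})).
Qed.

Lemma conj_schubert_solutions s k d (W : 'I_s -> {vspace 'rV[C]_m}) H :
  (forall i, real_plane (W i)) ->
  schubert_solutions k d W H -> schubert_solutions k d W (conj_plane H).
Proof.
move=> Wr [dimH HW]; split=> [|i]; rewrite /grass /= ?dim_conj_plane //.
by rewrite (Wr i) -conj_planeI dim_conj_plane.
Qed.

End ConjPlane.

(** * Coordinate subspaces and diagonal matrices *)

Section CoordinateRows.
Variables (F : fieldType) (n : nat).

Definition coord_rows (I : {set 'I_n}) : 'M[F]_(#|I|, n) :=
  rowsub enum_val 1%:M.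

Lemma sub_coord_rowsP (I : {set 'I_n}) (u : 'rV[F]_n) :
  reflect (forall i, i \notin I -> u 0 i = 0) (u <= coord_rows I)%MS.
Proof.
apply: (iffP submxP) => [[a ->] i iI | uI].
  rewrite mxE big1 // => j _; rewrite !mxE.
  case: eqP => [e|_]; last by rewrite mulr0.
  by rewrite -e enum_valP in iI.
rewrite [u]row_sum_delta; exists (colsub enum_val u); rewrite mulmx_sum_row.
rewrite (bigID (mem I)) /= [X in _ + X]big1 ?addr0 => [|i iI]; last first.
  by rewrite uI ?scale0r.
rewrite big_enum_val; apply: eq_bigr => j _.
by rewrite !mxE row_rowsub row1.
Qed.

Lemma mxrank_coord_rows I : \rank (coord_rows I) = #|I|.
Proof.
apply/eqP/row_freeP; exists (colsub enum_val 1%:M).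
apply/matrixP => i j; rewrite !mxE (bigD1 (enum_val i)) //= !mxE eqxx mul1r.
rewrite big1 ?addr0 => [|k ki]; first by rewrite (inj_eq enum_val_inj).
by rewrite !mxE eq_sym (negPf ki) mul0r.
Qed.

End CoordinateRows.

Arguments coord_rows {F n} I.

(* Lagrange interpolation at the eigenvalues projects onto each coordinate. *)
Lemma stable_coord_rows (F : fieldType) n p (B : 'M[F]_(p, n)) (d : 'rV[F]_n) :
  injective (d 0) -> (B *m diag_mx d <= B)%MS ->
  (B :=: coord_rows [set i | (delta_mx 0 i : 'rV_n) <= B])%MS.
Proof.
case: n B d => [|n'] B d d_inj Bd.
  by apply/eqmxP/andP; split; apply/row_subP => i;
    rewrite [row _ _]thinmx0 sub0mx.
apply/eqmxP/andP; split; last first.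
  apply/row_subP => j; rewrite row_rowsub row1.
  by have := enum_valP j; rewrite inE.
apply/row_subP => r; apply/sub_coord_rowsP => i; rewrite inE.
apply: contraNeq => ui; set u := row r B in ui *.
pose q := \prod_(j | j != i) ('X - (d 0 j)%:P).
have qi : q.[d 0 i] != 0.
  rewrite horner_prod; apply/prodf_neq0 => j ji.
  by rewrite hornerXsubC subr_eq0 (inj_eq d_inj) eq_sym.
have uq : u *m horner_mx (diag_mx d) q = (u 0 i * q.[d 0 i]) *: delta_mx 0 i.
  apply/rowP => j; rewrite horner_mx_diag mul_mx_diag !mxE eqxx /=.
  have [->|ji] := eqVneq j i; first by rewrite mulr1.
  rewrite mulr0 horner_prod (bigD1 j) //= hornerXsubC subrr mul0r mulr0 //.
have : (u *m horner_mx (diag_mx d) q <= B)%MS.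
  have st : stablemx <<B>>%MS (diag_mx d).
    by rewrite (eqmxMr _ (genmxE B)) genmxE.
  have := horner_mx_stable q st; rewrite (eqmxMr _ (genmxE B)) genmxE.
  by apply: submx_trans; apply: submxMr; apply: row_sub.
by rewrite uq; apply: submx_trans; rewrite eqmx_scale // mulf_neq0.
Qed.

(** * Solutions for a quadruple in normal form *)

Section NormalForm.
Variables (F : fieldType) (n : nat).

Definition normal_mx (E G : 'M[F]_(n, n + n)) (d : 'rV[F]_n) :
    'I_4 -> 'M[F]_(n, n + n) :=
  tnth [tuple E; G; E + G; diag_mx d *m E + G].

(** An entry of [d] may be 0 or 1; the last plane then meets the span of [G], respectively of
    [E + G]. *)
Definition normal_form (E G : 'M[F]_(n, n + n)) (d : 'rV[F]_n) : Prop :=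
  col_mx E G \in unitmx /\ injective (d 0).

Definition coord_plane (E G : 'M[F]_(n, n + n)) (I : {set 'I_n}) :=
  rowspan (col_mx (coord_rows I *m E) (coord_rows I *m G)).

Section Frame.
Variables (E G : 'M[F]_(n, n + n)) (d : 'rV[F]_n).
Hypothesis EGd : normal_form E G d.

(** [M *m L] and [M *m R] are the coordinates of the rows of [M] along [E] and along [G]; thus [L]
    kills [G] and [R] kills [E]. *)
Let L : 'M[F]_(n + n, n) := lsubmx (invmx (col_mx E G)).
Let R : 'M[F]_(n + n, n) := rsubmx (invmx (col_mx E G)).

Let frameK : [/\ E *m L = 1%:M, E *m R = 0, G *m L = 0 & G *m R = 1%:M].
Proof.
have [T_unit _] := EGd.
have := mulmxV T_unit; rewrite -[invmx _]hsubmxK mul_col_row scalar_mx_block.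
by case/eq_block_mx.
Qed.

Let frame_sum : L *m E + R *m G = 1%:M.
Proof.
by have [T_unit _] := EGd; rewrite -mul_row_col hsubmxK mulVmx.
Qed.

Let EL : E *m L = 1%:M. Proof. by case: frameK. Qed.
Let ER : E *m R = 0. Proof. by case: frameK. Qed.
Let GL : G *m L = 0. Proof. by case: frameK. Qed.
Let GR : G *m R = 1%:M. Proof. by case: frameK. Qed.

Let sub_coord_plane k (M : 'M[F]_(k, n + n)) I :
  (M <= col_mx (coord_rows I *m E) (coord_rows I *m G))%MS =
  (M *m L <= coord_rows I)%MS && (M *m R <= coord_rows I)%MS.
Proof.
apply/idP/andP => [/submxP[a ->]|[ML MR]].
  rewrite -[a]hsubmxK mul_row_col !mulmxDl -!mulmxA EL ER GL GR.
  by rewrite !mulmx0 !mulmx1 addr0 add0r !submxMl.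
rewrite -[M]mulmx1 -frame_sum mulmxDr !mulmxA -addsmxE.
by apply: addmx_sub_adds; apply: submxMr.
Qed.

Lemma coord_planeS I J :
  (coord_plane E G I <= coord_plane E G J)%VS = (I \subset J).
Proof.
rewrite rowspanS sub_coord_plane !mul_col_mx -!mulmxA EL ER GL GR.
rewrite !mulmx0 !mulmx1 !col_mx_sub !sub0mx andbT /= andbb.
apply/idP/fintype.subsetP => [IJ i iI | IJ].
  have := row_subP IJ (enum_rank_in iI i); rewrite row_rowsub row1.
  rewrite enum_rankK_in // => /sub_coord_rowsP/(_ i) H.
  by apply: contraT => /H/eqP; rewrite mxE !eqxx oner_eq0.
apply/row_subP => j; apply/sub_coord_rowsP => i iJ.
rewrite row_rowsub row1 mxE eqxx /=; case: eqP => [e|//].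
by rewrite e IJ ?enum_valP in iJ.
Qed.

Lemma dim_coord_plane I : \dim (coord_plane E G I) = (#|I| + #|I|)%N.
Proof.
have [T_unit _] := EGd.
rewrite dim_rowspan (_ : col_mx _ _ =
  block_mx (coord_rows I) 0 0 (coord_rows I) *m col_mx E G).
  by rewrite mxrankMfree ?row_free_unit // rank_diag_block_mx mxrank_coord_rows.
by rewrite mul_block_col !mul0mx addr0 add0r.
Qed.

Lemma normal_mx_free i : row_free (normal_mx E G d i).
Proof.
apply/row_freeP; case: i => -[|[|[|[|//]]]] ?.
- by exists L.
- by exists R.
- by exists L; rewrite mulmxDl EL GL addr0.
- by exists R; rewrite mulmxDl -mulmxA ER GR mulmx0 add0r.
Qed.

(** All four planes have diagonal coordinate blocks, and diagonal matrices preserve coordinate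
    subspaces. *)
Let normal_mxK i : exists a b : 'rV[F]_n,
  normal_mx E G d i *m L = diag_mx a /\ normal_mx E G d i *m R = diag_mx b.
Proof.
case: i => -[|[|[|[|//]]]] ?.
- by exists (const_mx 1), 0; rewrite diag_const_mx raddf0.
- by exists 0, (const_mx 1); rewrite raddf0 diag_const_mx.
- exists (const_mx 1), (const_mx 1); rewrite diag_const_mx.
  by rewrite !mulmxDl EL GL ER GR addr0 add0r.
- exists d, (const_mx 1); rewrite diag_const_mx.
  by rewrite !mulmxDl -!mulmxA EL GL ER GR mulmx1 mulmx0 addr0 add0r.
Qed.

Let coord_rows_diag (a : 'rV[F]_n) I :
  (coord_rows I *m diag_mx a <= coord_rows I)%MS.
Proof.
apply/row_subP => j; rewrite row_mul; apply/sub_coord_rowsP => i iI.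
have /sub_coord_rowsP/(_ i iI) := row_sub j (coord_rows I : 'M[F]__).
by rewrite mul_mx_diag [in X in _ -> X]mxE => ->; rewrite mul0r.
Qed.

(** The rows indexed by [I] of each of the four matrices are [k] independent vectors lying in both
    planes. *)
Lemma coord_plane_solution k (I : {set 'I_n}) : #|I| = k ->
  schubert_solutions (k + k) k (fun i => rowspan (normal_mx E G d i))
    (coord_plane E G I).
Proof.
move=> Ik; split=> [|i]; first by rewrite /grass /= dim_coord_plane Ik.
have <- : \dim (rowspan (coord_rows I *m normal_mx E G d i)) = k.
  by rewrite dim_rowspan mxrankMfree ?normal_mx_free // mxrank_coord_rows.
apply: dimvS; rewrite subv_cap !rowspanS submxMl andbT sub_coord_plane.
have [a [b [Ha Hb]]] := normal_mxK i.
by rewrite -!mulmxA Ha Hb !coord_rows_diag.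
Qed.

(** [X] recovers the rows of [W] from their images under [Y], so [Y] is injective on the row space
    of [W], hence on its intersection with [H]. *)
Let mxrank_cap_mul p q r (H : 'M[F]_(p, n + n)) (W : 'M[F]_(q, n + n))
    (Y : 'M[F]_(n + n, r)) (X : 'M[F]_(r, n + n)) :
  W *m Y *m X = W -> \rank ((H :&: W)%MS *m Y) = \rank (H :&: W)%MS.
Proof.
move=> WK; apply/eqP; rewrite eqn_leq mxrankM_maxl /=.
have /submxP[c e] := capmxSr H W.
have ZK : (H :&: W)%MS *m Y *m X = (H :&: W)%MS.
  by rewrite e -!mulmxA (mulmxA W) WK.
by rewrite -{1}ZK mxrankM_maxl.
Qed.

(** The conditions on planes 0 and 1 bound the ranks of both projections of [H] by [k]. The
    projections of its intersections with planes 2 and 3 already reach rank [k], so they fill the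
    projections of [H]. *)
Lemma solution_stable k p (H : 'M[F]_(p, n + n)) :
  \rank H = (k + k)%N ->
  (forall i, k <= \rank (H :&: normal_mx E G d i)%MS)%N ->
  [/\ \rank (H *m R) = k, (H *m R *m diag_mx d <= H *m R)%MS
    & (H *m L :=: H *m R)%MS].
Proof.
move=> rkH HW.
(* Rank-nullity: the part of [H] killed by [Y] contains [H :&: W], which leaves rank at most [k] for
   the image. *)
have le_k q (Y : 'M[F]_(n + n, n)) (W : 'M[F]_(q, n + n)) :
    W *m Y = 0 -> (k <= \rank (H :&: W)%MS)%N -> (\rank (H *m Y) <= k)%N.
  move=> WY kW; rewrite -(leq_add2r k) -rkH -(mxrank_mul_ker H Y) leq_add2l.
  by apply: leq_trans kW _; apply/mxrankS/capmxS => //; apply/sub_kermxP.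
have HL_k : (\rank (H *m L) <= k)%N by apply: le_k GL (HW 1).
have HR_k : (\rank (H *m R) <= k)%N by apply: le_k ER (HW 0).
have eq_k q r (A : 'M[F]_(q, n)) (B : 'M[F]_(r, n)) :
    (k <= \rank A)%N -> (A <= B)%MS -> (\rank B <= k)%N -> (A :=: B)%MS.
  move=> kA AB Bk; apply/eqmxP; rewrite -(geq_leqif (mxrank_leqif_eq AB)).
  exact: leq_trans Bk kA.
set Z := (H :&: (E + G)%R)%MS; set Z' := (H :&: (diag_mx d *m E + G)%R)%MS.
have [W2L W2R] : (E + G) *m L = 1%:M /\ (E + G) *m R = 1%:M.
  by rewrite !mulmxDl EL GL ER GR addr0 add0r.
have [W3L W3R] : (diag_mx d *m E + G) *m L = diag_mx d /\
    (diag_mx d *m E + G) *m R = 1%:M.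
  by rewrite !mulmxDl -!mulmxA EL GL ER GR mulmx1 mulmx0 addr0 add0r.
(* On plane 2 the two coordinates agree; on plane 3 they differ by the factor [diag_mx d]. *)
have ZL : Z *m L = Z *m R.
  by have /submxP[c e] := capmxSr H (E + G); rewrite /Z e -!mulmxA W2L W2R.
have Z'L : Z' *m L = Z' *m R *m diag_mx d.
  have /submxP[c e] := capmxSr H (diag_mx d *m E + G).
  by rewrite /Z' e -!(mulmxA c) W3L W3R mul1mx.
have kZ : (k <= \rank (Z *m R))%N.
  rewrite (@mxrank_cap_mul _ _ _ _ _ _ (E + G)) ?W2R ?mul1mx //.
  exact: (HW (@Ordinal 4 2 isT)).
have kZ' : (k <= \rank (Z' *m R))%N.
  rewrite (@mxrank_cap_mul _ _ _ _ _ _ (diag_mx d *m E + G)) ?W3R ?mul1mx //.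
  exact: (HW (@Ordinal 4 3 isT)).
have ZH : (Z *m R :=: H *m R)%MS.
  by apply: eq_k HR_k => //; apply/submxMr/capmxSl.
have Z'H : (Z' *m R :=: H *m R)%MS.
  by apply: eq_k HR_k => //; apply/submxMr/capmxSl.
have HLR : (H *m L :=: H *m R)%MS.
  apply: eqmx_trans ZH; apply/eqmx_sym/eq_k => //; rewrite -ZL.
  exact/submxMr/capmxSl.
split=> //; first by apply/eqP; rewrite eqn_leq HR_k -ZH.
(* As [Z' *m R] spans [H *m R], applying [diag_mx d] gives the row space of [Z' *m L], contained in
   that of [H *m L]. *)
by rewrite -HLR -(eqmxMr _ Z'H) -Z'L; apply/submxMr/capmxSl.
Qed.

Lemma schubert_solutionsE k :
  schubert_solutions (k + k) k (fun i => rowspan (normal_mx E G d i)) =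
  ((coord_plane E G) @` [set` [set I : {set 'I_n} | #|I| == k]%SET])%classic.
Proof.
apply/seteqP; split=> [H [] | _ [I /= + <-]]; last first.
  by rewrite inE => /eqP; apply: coord_plane_solution.
have [M ->] := vspace_rowspan H; rewrite /grass /= dim_rowspan => rkM HW.
have {}HW i : (k <= \rank (M :&: normal_mx E G d i)%MS)%N.
  by rewrite -dim_rowspan -capv_rowspan.
have [rkMR MRd MLR] := solution_stable rkM HW.
have [_ d_inj] := EGd; have := stable_coord_rows d_inj MRd.
set I := [set i | _] => MRI.
have Ik : #|I| = k by rewrite -rkMR MRI mxrank_coord_rows.
exists I; first by rewrite /= inE Ik.
(* Both coordinates of [M] lie in the coordinate subspace of [I], which gives one inclusion; both
   dimensions are [k + k]. *)
apply/eqP; rewrite eq_sym eqEdim.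
rewrite rowspanS sub_coord_plane MLR !MRI !submx_refl.
by rewrite dim_coord_plane Ik dim_rowspan rkM leqnn.
Qed.

End Frame.

End NormalForm.

(** * Real solutions and the involution induced by conjugation *)

Section RealSolutions.
Variables (C : numClosedFieldType) (n : nat).
Variables (E G : 'M[C]_(n, n + n)) (d : 'rV[C]_n).
Hypothesis EGd : normal_form E G d.

Let W (i : 'I_4) := rowspan (normal_mx E G d i).
Hypothesis Wreal : forall i, real_plane (W i).

Local Notation P := (coord_plane E G).

Let P_inj : injective P.
Proof.
move=> I J IJ; apply/eqP.
by rewrite finset.eqEsubset -!(coord_planeS EGd) IJ !subvv.
Qed.

Let solE k := schubert_solutionsE EGd k.

Let conj_coord_plane (I : {set 'I_n}) :
  exists J : {set 'I_n}, #|J| = #|I| /\ conj_plane (P I) = P J.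
Proof.
have /(conj_schubert_solutions Wreal) :=
  coord_plane_solution EGd (erefl #|I|).
by rewrite solE => -[J /=]; rewrite inE => /eqP JI <-; exists J.
Qed.

(** [s] is read off from singletons. For general [I], the conjugate is [P J] with [J] of the same
    size, and it contains [P [set s i]] for every [i] in [I]; so [J] is the image of [I]. *)
Lemma conj_permutes_coord_planes : exists2 s : 'I_n -> 'I_n, involutive s &
  forall I : {set 'I_n}, conj_plane (P I) = P (s @: I).
Proof.
have [i|s Ps] := @choice _ _
  (fun i j => conj_plane (P [set i]%SET) = P [set j]%SET).
  have [J [/eqP]] := conj_coord_plane [set i]%SET.
  by rewrite cards1 => /cards1P[j ->]; exists j.
have sK : involutive s.
  move=> i; apply/finset.set1_inj/P_inj.
  by rewrite -Ps -Ps conj_planeK.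
exists s => // I; have [J [JI PJ]] := conj_coord_plane I.
rewrite PJ; congr P; apply/esym/eqP; rewrite eqEcard.
rewrite JI (card_imset _ (inv_inj sK)) leqnn andbT.
apply/fintype.subsetP => _ /imsetP[i iI ->].
rewrite -finset.sub1set -(coord_planeS EGd) -Ps -PJ; apply: conj_planeS.
by rewrite (coord_planeS EGd) finset.sub1set.
Qed.

Lemma card_solutions k :
  (schubert_solutions (k + k) k W #= `I_('C(n, k)))%card.
Proof.
rewrite solE -[X in 'C(X, k)]card_ord -card_draws.
by apply: card_eq_imfset => I J _ _; apply: P_inj.
Qed.

Lemma card_real_solutions : exists r c : nat,
  [/\ (schubert_solutions 2 1 W `&` [set Q | real_plane Q]
        #= `I_r)%classic%card,
      (conj_pairs (schubert_solutions 2 1 W) #= `I_c)%card,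
      (r + 2 * c)%N = n &
      (schubert_solutions 4 2 W `&` [set H | real_plane H]
        #= `I_('C(r, 2) + c))%classic%card].
Proof.
have [s sK Ps] := conj_permutes_coord_planes.
have realP I : real_plane (P I) <-> s @: I = I.
  by rewrite /real_plane Ps; split=> [/P_inj/esym | ->].
exists #|fixpts s|, #|moved_pairs s|; split.
- rewrite (_ : _ `&` _ = (fun i => P [set i]%SET) @` [set` fixpts s])%classic.
    by apply: card_eq_imfset => i j _ _ /P_inj/finset.set1_inj.
  apply/seteqP; split=> [Q [/=]|_ [i /= + <-]].
    rewrite (solE 1) => -[I /=]; rewrite inE => /cards1P[i ->] <- /realP.
    by rewrite imset_set1 => /finset.set1_inj si; exists i; rewrite //= inE si.
  rewrite inE => /eqP si; split; last by apply/realP; rewrite imset_set1 si.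
  by apply: (coord_plane_solution EGd (k := 1)); rewrite cards1.
(* A conjugate pair is a set of planes: [f] turns a set of indices into a set of planes, and a
   2-cycle into a nonreal plane with its conjugate. *)
- pose f (J : {set 'I_n}) := ((fun i => P [set i]%SET) @` [set` J])%classic.
  have f_inj : injective f.
    move=> I J /seteqP[IJ JI]; apply/eqP; rewrite finset.eqEsubset.
    by apply/andP; split; apply/fintype.subsetP => i iI;
      [have [] := IJ (P [set i]%SET) | have [] := JI (P [set i]%SET)];
      do ?[by exists i]; move=> j /= ? /P_inj/finset.set1_inj <-.
  have fE i : f [set i; s i]%SET =
      [set P [set i]%SET; conj_plane (P [set i]%SET)]%classic.
    rewrite Ps imset_set1; apply/seteqP; split=> [_ [j /= + <-]|_ [->|->]].
    + by rewrite !inE => /orP[] /eqP ->; [left | right].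
    + by exists i; rewrite //= !inE eqxx.
    + by exists (s i); rewrite //= !inE eqxx orbT.
  rewrite (_ : conj_pairs _ = f @` [set` moved_pairs s])%classic.
    by apply: card_eq_imfset => I J _ _; apply: f_inj.
  apply/seteqP; split=> [_ [Q [/= + _ + ->]]|_ [J /= /imsetP[i si ->] <-]].
    rewrite (solE 1) => -[I /=]; rewrite inE => /cards1P[i ->] <-.
    rewrite -fE Ps imset_set1 => si; exists [set i; s i]%SET => //=.
    by apply/imsetP; exists i; rewrite // !inE; apply/eqP => e; rewrite e in si.
  have sol1 j : schubert_solutions 2 1 W (P [set j]%SET).
    by apply: (coord_plane_solution EGd (k := 1)); rewrite cards1.
  exists (P [set i]%SET); split=> //; rewrite ?fE ?Ps ?imset_set1 //.
  by move/P_inj/finset.set1_inj => e; rewrite !inE -e eqxx in si.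
- by rewrite card_fixpts_moved_pairs // card_ord.
- rewrite -card_stable_pairs //.
  rewrite (_ : _ `&` _ = P @` [set` [set J : {set 'I_n} |
      (#|J| == 2) && (s @: J == J)]%SET])%classic.
    by apply: card_eq_imfset => I J _ _; apply: P_inj.
  apply/seteqP; split=> [Q [/=]|_ [J /= + <-]].
    rewrite (solE 2) => -[J /=]; rewrite inE => J2 <- /realP sJ.
    by exists J; rewrite //= inE J2 sJ eqxx.
  rewrite inE => /andP[/eqP J2 /eqP sJ]; split; last exact/realP.
  exact: (coord_plane_solution EGd (k := 2)).
Qed.

End RealSolutions.

(** * Diagonalization with distinct eigenvalues *)

Section Diagonalization.
Variables (F : closedFieldType) (n : nat).
Implicit Types A P : 'M[F]_n.+1.

(** If the characteristic polynomial and its derivative shared a root, an eigenvector for it would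
    be killed by the derivative evaluated at [A], an invertible matrix. *)
Lemma separable_char_poly A :
  \det (horner_mx A (char_poly A)^`()) != 0 -> separable_poly (char_poly A).
Proof.
rewrite -unitfE -unitmxE => A_unit.
rewrite unlock; apply: Pdiv.ClosedField.root_coprimep => a.
rewrite -eigenvalue_root_char => /eigenvalueP[v vA v0].
apply: contra_neq v0 => /eqP/factor_theorem[q qE].
(* Commuting the factors of the derivative puts [A - a] next to the row vector [v], which it
   kills. *)
rewrite -[v](mulmxK A_unit) qE mulrC rmorphM /= [in X in X *m invmx _]mulmxA.
rewrite rmorphB /= horner_mx_X horner_mx_C mulmxBr vA mul_mx_scalar subrr.
by rewrite !mul0mx.
Qed.

Lemma char_poly_conj A B P :
  P \in unitmx -> P *m A = B *m P -> char_poly A = char_poly B.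
Proof.
move=> P_unit PA; have detP : \det (map_mx polyC P) != 0.
  by rewrite det_map_mx polyC_eq0 -unitfE -unitmxE.
apply: (mulfI detP); rewrite [RHS]mulrC -!det_mulmx !mulmxBr !mulmxBl.
by rewrite -!map_mxM PA scalar_mxC.
Qed.

(** The minimal polynomial divides a product of distinct linear factors, so [A] is diagonalizable.
    Similarity carries separability over to the diagonal matrix, whose entries are therefore
    distinct. *)
Lemma separable_diagonalizable A : separable_poly (char_poly A) ->
  exists P (d : 'rV[F]_n.+1),
    [/\ P \in unitmx, injective (d 0) & P *m A = diag_mx d *m P].
Proof.
move=> A_sep.
have [rs def_A] := closed_field_poly_normal (char_poly A).
rewrite (monicP (char_poly_monic A)) scale1r in def_A.
have : diagonalizable A.
  apply/diagonalizableP; exists rs.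
    by rewrite -separable_prod_XsubC -def_A.
  by rewrite -def_A mxminpoly_dvd_char.
case=> P P_unit /diagonalizable_forPex[d] /(simmxPp _) PA.
have {}PA : P *m A = diag_mx d *m P.
  by apply: PA; rewrite submx_full ?row_full_unit.
exists P, d; split=> //; move: A_sep.
rewrite (char_poly_conj P_unit PA) (char_poly_trig (diag_mx_is_trig _)).
rewrite (_ : \prod_(i < _) _ =
    \prod_(x <- [seq d 0 i | i <- enum 'I_n.+1]) ('X - x%:P)).
  by rewrite separable_prod_XsubC => /injectiveP.
rewrite big_map big_enum /=; apply: eq_bigr => i _.
by rewrite mxE eqxx.
Qed.

End Diagonalization.

(** * A polynomial criterion for the normal form *)

(* With T = col_mx (M 0) (M 1), we have \det T *: M j = X j *m M 0 + Y j *m M 1,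
   so M 2 and M 3 span the graphs of X 2^-1 Y 2 and X 3^-1 Y 3, and pencil_mx is
   the quotient X 2^-1 Y 2 Y 3^-1 X 3, adjugates replacing inverses so as to
   remain polynomial.  The last factor of genericity stands for the discriminant
   of the characteristic polynomial of pencil_mx. *)
Section Genericity.
Variables (R : comNzRingType) (n : nat).
Implicit Type M : 'I_4 -> 'M[R]_(n.+1, n.+1 + n.+1).

Definition pencil_X M j := lsubmx (M j *m \adj (col_mx (M 0) (M 1))).
Definition pencil_Y M j := rsubmx (M j *m \adj (col_mx (M 0) (M 1))).

Definition pencil_mx M :=
  \adj (pencil_X M 2) *m pencil_Y M 2 *m \adj (pencil_Y M 3) *m pencil_X M 3.

Definition genericity M :=
  \det (col_mx (M 0) (M 1)) * \det (pencil_X M 2) * \det (pencil_Y M 2)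
  * \det (pencil_Y M 3)
  * \det (horner_mx (pencil_mx M) (char_poly (pencil_mx M))^`()).

End Genericity.

(** Every ingredient commutes with ring morphisms; this allows evaluating [genericity] of a matrix
    of polynomials at a point. *)
Lemma map_genericity (R S : comNzRingType) (f : {rmorphism R -> S}) n
    (M : 'I_4 -> 'M[R]_(n.+1, n.+1 + n.+1)) :
  f (genericity M) = genericity (fun i => map_mx f (M i)).
Proof.
have fX j : map_mx f (pencil_X M j) = pencil_X (fun i => map_mx f (M i)) j.
  by rewrite /pencil_X map_lsubmx map_mxM map_mx_adj map_col_mx.
have fY j : map_mx f (pencil_Y M j) = pencil_Y (fun i => map_mx f (M i)) j.
  by rewrite /pencil_Y map_rsubmx map_mxM map_mx_adj map_col_mx.
have fN : map_mx f (pencil_mx M) = pencil_mx (fun i => map_mx f (M i)).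
  by rewrite /pencil_mx !map_mxM !map_mx_adj !fX !fY.
rewrite /genericity !rmorphM /= -!det_map_mx map_col_mx !fX !fY.
by rewrite map_horner_mx -deriv_map map_char_poly fN.
Qed.

Lemma adj_invmx (F : fieldType) n (A : 'M[F]_n) :
  A \in unitmx -> \adj A = \det A *: invmx A.
Proof.
move=> A_unit; rewrite -[LHS]mulmx1 -(mulmxV A_unit) mulmxA mul_adj_mx.
by rewrite mul_scalar_mx.
Qed.

Lemma eqmx_unit (F : fieldType) m n (g : 'M[F]_m) (A : 'M[F]_(m, n)) :
  g \in unitmx -> (g *m A :=: A)%MS.
Proof. by move=> g_unit; apply: eqmxMfull; rewrite row_full_unit. Qed.

Lemma ord4P (P : 'I_4 -> Prop) : P 0 -> P 1 -> P 2 -> P 3 -> forall i, P i.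
Proof.
move=> P0 P1 P2 P3 [[|[|[|[|//]]]] lt_i4].
- by rewrite (_ : Ordinal _ = 0) //; apply: val_inj.
- by rewrite (_ : Ordinal _ = 1) //; apply: val_inj.
- by rewrite (_ : Ordinal _ = 2) //; apply: val_inj.
- by rewrite (_ : Ordinal _ = 3) //; apply: val_inj.
Qed.

Lemma generic_normal_form (F : closedFieldType) n
    (M : 'I_4 -> 'M[F]_(n.+1, n.+1 + n.+1)) :
  genericity M != 0 -> exists E G d,
    normal_form E G d /\ forall i, (M i :=: normal_mx E G d i)%MS.
Proof.
rewrite /genericity !mulf_eq0 !negb_or -!andbA => /and5P[T_unit X_unit Y_unit].
move=> Y'_unit N_unit.
rewrite -!unitfE -!unitmxE in T_unit X_unit Y_unit Y'_unit.
set X := pencil_X M 2 in X_unit *; set Y := pencil_Y M 2 in Y_unit *.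
set Y' := pencil_Y M 3 in Y'_unit *; pose X' := pencil_X M 3.
set T := col_mx _ _ in T_unit; set N := pencil_mx M in N_unit.
have detT : \det T != 0 by rewrite -unitfE -unitmxE.
have expand j : \det T *: M j = pencil_X M j *m M 0 + pencil_Y M j *m M 1.
  by rewrite -mul_row_col hsubmxK -mulmxA mul_adj_mx mul_mx_scalar.
have [P [D [P_unit D_inj PN]]] :=
  separable_diagonalizable (separable_char_poly N_unit).
(* [c] collects the determinants contributed by the adjugates of [X] and [Y'] in [pencil_mx]. *)
pose c := \det X * \det Y'.
have c0 : c != 0 by rewrite mulf_neq0 // -unitfE -unitmxE.
have NE : N = c *: (invmx X *m Y *m invmx Y' *m X').
  rewrite /N /pencil_mx -/X -/Y -/Y' -/X' (adj_invmx X_unit) (adj_invmx Y'_unit).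
  by rewrite -!scalemxAl -scalemxAr -!scalemxAl scalerA.
(* [P] diagonalizes the pencil, and [G] is chosen so that [E + G] equals
   [P *m invmx X *m (\det T *: M 2)]. *)
pose E := P *m M 0; pose G := P *m invmx X *m Y *m M 1.
exists E, G, (c^-1 *: D); split; first split.
- rewrite (_ : col_mx E G = block_mx P 0 0 (P *m invmx X *m Y) *m T).
    rewrite unitmx_mul block_diag_mx_unit !unitmx_mul unitmx_inv.
    by rewrite P_unit X_unit Y_unit.
  by rewrite mul_block_col !mul0mx addr0 add0r.
- by move=> i j; rewrite !mxE => /(mulfI (invr_neq0 c0))/D_inj.
have scaleT j : (M j :=: \det T *: M j)%MS by apply/eqmx_sym/eqmx_scale.
apply: ord4P; apply: eqmx_sym.
- exact: eqmx_unit.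
- by apply: eqmx_unit; rewrite !unitmx_mul unitmx_inv P_unit X_unit Y_unit.
- apply/eqmx_sym/(eqmx_trans (scaleT _))/eqmx_sym.
  rewrite (_ : normal_mx _ _ _ _ = P *m invmx X *m (\det T *: M 2)).
    by apply: eqmx_unit; rewrite !unitmx_mul unitmx_inv P_unit X_unit.
  rewrite [LHS](_ : _ = E + G) // expand mulmxDr -/X -/Y.
  by rewrite /E /G !mulmxA mulmxKV.
- apply/eqmx_sym/(eqmx_trans (scaleT _))/eqmx_sym.
  rewrite (_ : normal_mx _ _ _ _ =
      P *m invmx X *m Y *m invmx Y' *m (\det T *: M 3)).
    by apply: eqmx_unit; rewrite !unitmx_mul !unitmx_inv P_unit X_unit Y_unit.
  rewrite expand mulmxDr -/X' -/Y' (mulmxA _ Y') mulmxKV //.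
  rewrite [LHS](_ : _ = diag_mx (c^-1 *: D) *m E + G) //.
  (* The coefficient of [M 0] is [c^-1 *: (P *m N)], which the diagonalization turns into
     [diag_mx (c^-1 *: D) *m P]. *)
  congr (_ + _); rewrite linearZ /= -scalemxAl mulmxA -PN NE.
  by rewrite -scalemxAr -scalemxAl scalerA mulVf // scale1r !mulmxA.
Qed.

(** All pencil blocks are the scalar [t] except [pencil_X M 3], which is [t *: diag_mx d]; so
    [pencil_mx M] is a nonzero multiple of [diag_mx d]. *)
Lemma normal_form_generic (F : fieldType) n
    (E G : 'M[F]_(n.+1, n.+1 + n.+1)) (d : 'rV[F]_n.+1) :
  normal_form E G d -> genericity (normal_mx E G d) != 0.
Proof.
case=> T_unit d_inj; set M := normal_mx E G d.
have detT : \det (col_mx E G) != 0 by rewrite -unitfE -unitmxE.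
set t := \det _ in detT; set A := \adj (col_mx E G).
have [EA GA] : E *m A = row_mx t%:M 0 /\ G *m A = row_mx 0 t%:M.
  have := mul_mx_adj (col_mx E G).
  rewrite mul_col_mx scalar_mx_block block_mxEv.
  by case/eq_col_mx.
have X2 : pencil_X M 2 = t%:M.
  by rewrite /pencil_X -/A [M 2]/= mulmxDl EA GA add_row_mx addr0 row_mxKl.
have Y2 : pencil_Y M 2 = t%:M.
  by rewrite /pencil_Y -/A mulmxDl EA GA add_row_mx add0r row_mxKr.
have X3 : pencil_X M 3 = t *: diag_mx d.
  rewrite /pencil_X -/A mulmxDl -mulmxA EA GA mul_mx_row add_row_mx addr0.
  by rewrite row_mxKl mul_mx_scalar.
have Y3 : pencil_Y M 3 = t%:M.
  rewrite /pencil_Y -/A mulmxDl -mulmxA EA GA mul_mx_row add_row_mx mulmx0.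
  by rewrite add0r row_mxKr.
have t_unit : (t%:M : 'M[F]_n.+1) \in unitmx.
  by rewrite unitmxE det_scalar unitfE expf_neq0.
have D0 : \det (t%:M : 'M[F]_n.+1) != 0 by rewrite -unitfE -unitmxE.
have [c c0 NE] : exists2 c, c != 0 & pencil_mx M = diag_mx (c *: d).
  set D := \det _ in D0; exists (D * t^-1 * t * (D * t^-1) * t).
    by rewrite !mulf_neq0 ?invr_neq0.
  rewrite /pencil_mx X2 Y2 X3 Y3 !adj_invmx // invmx_scalar !scale_scalar_mx.
  by rewrite -!scalar_mxM mul_scalar_mx scalerA linearZ.
rewrite /genericity X2 Y2 Y3 NE !mulf_neq0 //.
(* The last factor is the product of the values of the derivative at the eigenvalues, which are
   simple roots. *)
rewrite horner_mx_diag det_diag; apply/prodf_neq0 => i _; rewrite mxE.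
have -> : char_poly (diag_mx (c *: d)) =
    \prod_(x <- codom ((c *: d) 0)) ('X - x%:P).
  rewrite (char_poly_trig (diag_mx_is_trig _)) big_image /=.
  by apply: eq_bigr => j _; rewrite mxE eqxx.
set p := \prod_(x <- _) _.
have : separable_poly p.
  rewrite separable_prod_XsubC; apply/injectiveP => j k.
  by rewrite !mxE => /(mulfI c0)/d_inj.
rewrite unlock => /coprimep_root; apply.
by rewrite root_prod_XsubC codom_f.
Qed.

(** * The open set of quadruples in normal form *)

Definition normal_quadruples (F : fieldType) n :
    set ('I_4 -> {vspace 'rV[F]_(n + n)}) :=
  [set W | exists E G d,
    normal_form E G d /\ W = fun i => rowspan (normal_mx E G d i)]%classic.

(* Every basis g of the W_i contributes its own polynomial, so that the
   genericity polynomial need not be shown invariant under changes of bases. *)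
Lemma normal_quadruples_open (F : closedFieldType) n :
  zariski_open n.+1 (@normal_quadruples F n.+1).
Proof.
set N := n.+1; pose m := (4 * (N * (N + N)))%N.
split=> [_ [E [G [d [EGd ->]]]] i|].
  by rewrite /grass /= dim_rowspan; apply/eqP/(normal_mx_free EGd).
(* Matrices of independent variables, numbered in the order of [entries]. *)
pose gen (i : 'I_4) : 'M[mpoly.mpoly m F]_(N, N + N) :=
  \matrix_(k, l) mpoly.mpolyX F (mpoly.mnm1 (mxvec_index i (mxvec_index k l))).
pose poly (g : 'I_4 -> 'M[F]_N) : mpoly.mpoly m F :=
  genericity (fun i => map_mx (@mpoly.mpolyC m F) (g i) *m gen i).
have polyE g M : mpoly.meval (fun j => entries M 0 j) (poly g) =
    genericity (fun i => g i *m M i).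
  rewrite (map_genericity (mpoly.meval _ : {rmorphism mpoly.mpoly m F -> F})).
  congr genericity; apply/funext => i.
  rewrite map_mxM -map_mx_comp; congr (_ *m _).
    by apply/matrixP => k l; rewrite mxE /= mpoly.mevalC.
  apply/matrixP => k l.
  by rewrite !mxE /= mpoly.mevalXU /entries mxvecE mxE mxvecE.
exists [set poly g | g in setT]%classic => M M_free; split.
  move=> [E [G [d [EGd /funeqP MW]]]].
  (* [g] changes the given bases into the normal ones. *)
  have [i|g gM] := @choice _ _ (fun i gi => normal_mx E G d i = gi *m M i).
    by apply/submxP; rewrite -rowspanS -(MW i) subvv.
  exists (poly g); first by exists g.
  rewrite polyE (_ : (fun _ => _) = normal_mx E G d); last exact/funext.
  exact: normal_form_generic.
case=> _ [g _ <-]; rewrite polyE => /generic_normal_form[E [G [d [EGd gM]]]].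
exists E, G, d; split=> //; apply/funext => i.
apply/esym/eq_rowspan; apply: eqmx_trans (eqmx_sym (gM i)) _.
(* [g i] is an arbitrary square matrix, but [g i *m M i] has the full rank of [normal_mx], so it
   spans the whole row space of [M i]. *)
apply/eqmxP; rewrite -(geq_leqif (mxrank_leqif_eq (submxMl (g i) (M i)))).
by rewrite gM (eqP (normal_mx_free EGd i)) rank_leq_row.
Qed.

(** The standard basis serves, with [d] listing 0, ..., n - 1, which are distinct in characteristic
    zero. *)
Lemma normal_quadruples_nonempty (C : numClosedFieldType) n :
  (@normal_quadruples C n !=set0)%classic.
Proof.
pose E : 'M[C]_(n, n + n) := row_mx 1%:M 0.
pose G : 'M[C]_(n, n + n) := row_mx 0 1%:M.
pose d : 'rV[C]_n := \row_i i%:R.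
exists (fun i => rowspan (normal_mx E G d i)), E, G, d; split=> //; split.
  by rewrite -block_mxEv -scalar_mx_block unitmx1.
by move=> i j; rewrite !mxE => /eqP; rewrite eqr_nat => /eqP/val_inj.
Qed.

Local Open Scope classical_set_scope.
Local Open Scope card_scope.

Theorem theorem8p1 (R : realType) (n : nat) (n_ge4 : (4 <= n)%N) :
  exists U : set ('I_4 -> {vspace 'rV[R[i]]_(n + n)}),
    [/\ zariski_open n U, U !=set0 &
      forall W : 'I_4 -> {vspace 'rV[R[i]]_(n + n)},
        U W -> (forall i, real_plane (W i)) ->
        let sols := schubert_solutions 4 2 W in
        let aux := schubert_solutions 2 1 W in
        sols #= `I_'C(n, 2) /\
        exists r c : nat,
          [/\ aux `&` [set P | real_plane P] #= `I_r,
              conj_pairs aux #= `I_c,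
              (r + 2 * c)%N = n &
              sols `&` [set H | real_plane H] #= `I_('C(r, 2) + c)]].
Proof.
exists (@normal_quadruples R[i] n); split.
(* [n_ge4] makes [n] a successor, the form in which openness is stated. *)
- by case: n n_ge4 => // n _; apply: normal_quadruples_open.
- exact: normal_quadruples_nonempty.
- move=> W [E [G [d [EGd ->]]]] W_real; split.
    exact: (card_solutions EGd 2).
  exact: card_real_solutions.
Qed.
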